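(* Let $m\ge 1$ be an integer. The $m$-simplicial Lusternik–Schnirelmann category is an invariant of strong homotopy type: if simplicial complexes $K$ and $K'$ have the same strong homotopy type, then $\mathrm{scat}_m(K)=\mathrm{scat}_m(K')$.
   Context: Simplicial complexes are abstract simplicial complexes; the complexes $K,K'$ are assumed edge-path connected (any two vertices are joined by a finite chain of edges). Subcomplexes used in coverings and the test complexes $P$ below need not be connected. Two simplicial maps $\varphi,\psi:A\to B$ are contiguous, $\varphi\sim_c\psi$, if for every simplex $\{v_0,\dots,v_k\}$ of $A$ the set $\{\varphi(v_0),\dots,\varphi(v_k),\psi(v_0),\dots,\psi(v_k)\}$ is a simplex of $B$. They are in the same contiguity class, $\varphi\sim\psi$, if there is a finite sequence of simplicial maps $A\to B$ starting at $\varphi$ and ending at $\psi$ in which consecutive maps are contiguous. $K$ and $K'$ have the same strong homotopy type if there are simplicial maps $\varphi:K\to K'$ and $\psi:K'\to K$ with $\varphi\circ\psi\sim\mathrm{id}_{K'}$ and $\psi\circ\varphi\sim\mathrm{id}_K$. For $m\ge 1$, the $m$-simplicial LS category $\mathrm{scat}_m(A)$ is the least integer $k\ge 0$ such that $A$ has a cover by subcomplexes $A_0,\dots,A_k$ with the property that, for each $j$ and every simplicial map $\eta:P\to A_j$ from an $m$-dimensional simplicial complex $P$, one has $\iota_j\circ\eta\sim c_{a_0}\circ\eta$, where $\iota_j:A_j\to A$ is the inclusion and $c_{a_0}:A_j\to A$ is the constant map at a fixed vertex $a_0$ of $A$ (the choice of vertex is immaterial when $A$ is edge-path connected); it is $\infty$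 if there is no such cover. *)

(* Defs.v *)
From Stdlib Require Export Relation_Operators.
From mathcomp Require Export all_boot finmap.
From mathcomp Require Export boolp classical_sets.

Set Implicit Arguments.
Unset Strict Implicit.
Unset Printing Implicit Defensive.

Local Open Scope fset_scope.

(* The vertex type may be infinite, and all its elements are vertices. *)
Record scomplex := SComplex {
  vertex :> choiceType;
  simplex : {fset vertex} -> Prop;
  simplex_neq0 : forall s, simplex s -> s != fset0;
  simplex_face : forall s t, simplex s -> t `<=` s -> t != fset0 -> simplex t;
  simplex1 : forall v, simplex [fset v] }.

Record smap (A B : scomplex) := SMap {
  smap_fun :> A -> B;
  smap_simplex : forall s : {fset A},
    simplex s -> simplex [fset smap_fun x | x in s] }.

Lemma id_smap_simplex (A : scomplex) (s : {fset A}) :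
  simplex s -> simplex [fset id x | x in s].
Proof. by rewrite imfset_id. Qed.

Definition id_smap (A : scomplex) : smap A A := SMap (@id_smap_simplex A).

Lemma comp_smap_simplex (A B C : scomplex) (g : smap B C) (f : smap A B)
    (s : {fset A}) :
  simplex s -> simplex [fset (g \o f) x | x in s].
Proof.
move=> /(smap_simplex f)/(smap_simplex g).
by congr simplex; rewrite -imfset_comp.
Qed.

Definition comp_smap (A B C : scomplex) (g : smap B C) (f : smap A B) :
  smap A C := SMap (comp_smap_simplex g f).

Lemma cst_smap_simplex (A B : scomplex) (b : B) (s : {fset A}) :
  simplex s -> simplex [fset (fun=> b) x | x in s].
Proof.
move=> /simplex_neq0/fset0Pn[x xs].
suff -> : [fset (fun=> b) x | x in s] = [fset b] by exact: simplex1.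
apply/fsetP => y; rewrite inE; apply/imfsetP/eqP => [[z _ ->//]|->].
by exists x.
Qed.

Definition cst_smap (A B : scomplex) (b : B) : smap A B :=
  SMap (@cst_smap_simplex A B b).

Definition contiguous (A B : scomplex) (f g : smap A B) : Prop :=
  forall s : {fset A}, simplex s ->
    simplex ([fset f x | x in s] `|` [fset g x | x in s]).

Definition contiguity_class (A B : scomplex) : smap A B -> smap A B -> Prop :=
  clos_refl_trans (smap A B) (@contiguous A B).

Definition same_strong_homotopy_type (K K' : scomplex) : Prop :=
  exists (f : smap K K') (g : smap K' K),
    contiguity_class (comp_smap f g) (id_smap K') /\
    contiguity_class (comp_smap g f) (id_smap K).

(* When v = w, [fset v; w] is a vertex: edge-paths may stay in place. *)
Definition edge_path_connected (K : scomplex) : Prop :=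
  forall v w : K,
    clos_refl_trans K (fun x y => simplex [fset x; y]) v w.

(* Possibly empty, and not necessarily containing all vertices of A. *)
Record subcomplex (A : scomplex) := Subcomplex {
  sub_simplex : {fset A} -> Prop;
  sub_simplexW : forall s, sub_simplex s -> simplex s;
  sub_simplex_face : forall s t,
    sub_simplex s -> t `<=` s -> t != fset0 -> sub_simplex t }.

Section SubcomplexAsComplex.
Variables (A : scomplex) (L : subcomplex A).

Definition sub_vertex : choiceType :=
  set_type [set v : A | sub_simplex L [fset v]].

Definition sub_scomplex_simplex (s : {fset sub_vertex}) : Prop :=
  sub_simplex L [fset val x | x in s].

Lemma sub_scomplex_neq0 s : sub_scomplex_simplex s -> s != fset0.
Proof.
move=> /(@sub_simplexW _ _)/simplex_neq0; apply: contra_neq => ->.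
exact: imfset0.
Qed.

Lemma sub_scomplex_face s t :
  sub_scomplex_simplex s -> t `<=` s -> t != fset0 -> sub_scomplex_simplex t.
Proof.
move=> Ls /fsubsetP ts /fset0Pn[x xt]; apply: sub_simplex_face Ls _ _.
  apply/fsubsetP => _ /imfsetP[y /= yt ->].
  by apply/imfsetP; exists y => //=; exact: ts.
by apply/fset0Pn; exists (val x); apply/imfsetP; exists x.
Qed.

Lemma sub_scomplex1 v : sub_scomplex_simplex [fset v].
Proof.
rewrite /sub_scomplex_simplex.
suff -> : [fset val x | x in [fset v]] = [fset val v].
  by have := valP v; rewrite inE.
apply/fsetP => y; rewrite inE; apply/imfsetP/eqP => /= [[z]|->].
  by rewrite inE => /eqP -> ->.
by exists v; rewrite ?inE.
Qed.

Definition sub_scomplex : scomplex :=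
  SComplex sub_scomplex_neq0 sub_scomplex_face sub_scomplex1.

Lemma incl_smap_simplex (s : {fset sub_scomplex}) :
  simplex s -> simplex [fset (val : sub_scomplex -> A) x | x in s].
Proof. exact: sub_simplexW. Qed.

Definition incl_smap : smap sub_scomplex A := SMap incl_smap_simplex.

End SubcomplexAsComplex.

Coercion sub_scomplex : subcomplex >-> scomplex.

Definition has_dim (P : scomplex) (m : nat) : Prop :=
  (exists s : {fset P}, simplex s /\ #|` s| = m.+1) /\
  (forall s : {fset P}, simplex s -> #|` s| <= m.+1).

Definition m_categorical (m : nat) (A : scomplex) (a0 : A) (L : subcomplex A) :
  Prop :=
  forall (P : scomplex) (eta : smap P L), has_dim P m ->
    contiguity_class (comp_smap (incl_smap L) eta)
                     (comp_smap (cst_smap L a0) eta).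

Definition m_categorical_cover (m : nat) (A : scomplex) (a0 : A) (k : nat) :
  Prop :=
  exists L : 'I_k.+1 -> subcomplex A,
    (forall s : {fset A}, simplex s -> exists j, sub_simplex (L j) s) /\
    (forall j, m_categorical m a0 (L j)).

(* None stands for infinity; a0 is the vertex at which constant maps are taken. *)
Definition scat (m : nat) (A : scomplex) (a0 : A) : option nat :=
  match pselect (exists k, `[< m_categorical_cover m a0 k >]) with
  | left ex_cover => Some (ex_minn ex_cover)
  | right _ => None
  end.

Arguments scat m A a0 : clear implicits.

(* Main.v *)
(** If [g \o f] lies in the contiguity class of the identity of [K], an
    m-categorical cover of [K'] pulls back along [f] to one of [K] with as many
    members: for [eta : P -> f^-1 L], one has
    [eta ~ g \o f \o eta ~ g \o cst a0' \o eta ~ cst a0 \o eta], the last step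
    by moving the constant vertex [g a0'] to [a0] along an edge path. *)
Require Import Defs.

Set Implicit Arguments.
Unset Strict Implicit.
Unset Printing Implicit Defensive.

Local Open Scope fset_scope.

(** The two images of a simplex coincide, so their union is a single image. This allows passing
    between maps that differ only in their proof component. *)
Lemma contiguity_class_eqfun (A B : scomplex) (f g : smap A B) :
  f =1 g -> contiguity_class f g.
Proof.
move=> fg; apply: rt_step => s /(smap_simplex f).
suff -> : [fset g x | x in s] = [fset f x | x in s] by rewrite fsetUid.
by apply: eq_imfset => // x; rewrite fg.
Qed.

Lemma contiguity_class_sym (A B : scomplex) (f g : smap A B) :
  contiguity_class f g -> contiguity_class g f.
Proof.
elim=> [{}f {}g fg|{}f|f1 f2 f3 _ f21 _ f32]; last exact: rt_trans f32 f21.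
  by apply: rt_step => s /fg; rewrite fsetUC.
exact: rt_refl.
Qed.

(* The composites are given up to pointwise equality, since reassociating
   [comp_smap] changes the proof component of [smap]. *)
Lemma contiguity_class_comp (A B C D : scomplex) (h : smap C D)
    (e : smap A B) (f g : smap B C) (f' g' : smap A D) :
  f' =1 h \o f \o e -> g' =1 h \o g \o e ->
  contiguity_class f g -> contiguity_class f' g'.
Proof.
move=> f'E g'E fg.
apply: rt_trans (contiguity_class_eqfun (g := comp_smap h (comp_smap f e)) f'E) _.
have /contiguity_class_sym := contiguity_class_eqfun
  (g := comp_smap h (comp_smap g e)) g'E.
apply: rt_trans => {f'E g'E}.
elim: fg => [{}f {}g fg|{}f|f1 f2 f3 _ f12 _ f23]; last exact: rt_trans f12 f23.
  apply: rt_step => s /(smap_simplex e)/fg/(smap_simplex h).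
  by congr simplex; rewrite imfsetU -!imfset_comp.
exact: rt_refl.
Qed.

Lemma contiguity_class_cst (A B : scomplex) (v w : B) :
  edge_path_connected B ->
  contiguity_class (cst_smap A v) (cst_smap A w).
Proof.
move=> /(_ v w); elim=> [x y xy|x|x y z _ xy _ yz].
(* As [s] is nonempty, its images under the two constant maps have union exactly the edge
   [[fset x; y]]; [u] witnesses that both endpoints are attained. *)
- apply: rt_step => s /simplex_neq0/fset0Pn[u us].
  move: xy; congr simplex; apply/fsetP => t; rewrite !inE.
  apply/orP/orP => -[].
  + by move/eqP->; left; apply/imfsetP; exists u.
  + by move/eqP->; right; apply/imfsetP; exists u.
  + by case/imfsetP => ? _ -> /=; left.
  + by case/imfsetP => ? _ -> /=; right.
- exact: rt_refl.
- exact: rt_trans xy yz.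
Qed.

Section Preimage.
Variables (A B : scomplex) (f : smap A B) (L : subcomplex B).

(** The condition [simplex s] is imposed separately because [f] may send a non-simplex onto a
    simplex of [L]. *)
Definition preim_simplex (s : {fset A}) : Prop :=
  simplex s /\ sub_simplex L [fset f x | x in s].

Lemma preim_simplexW s : preim_simplex s -> simplex s.
Proof. by case. Qed.

Lemma preim_simplex_face s t :
  preim_simplex s -> t `<=` s -> t != fset0 -> preim_simplex t.
Proof.
move=> [As Ls] ts t0; split; first exact: simplex_face As ts t0.
apply: sub_simplex_face Ls _ _.
  apply/fsubsetP => _ /imfsetP[x /= xt ->].
  by apply/imfsetP; exists x => //=; apply: (fsubsetP ts).
by case/fset0Pn: t0 => x xt; apply/fset0Pn; exists (f x); apply/imfsetP; exists x.
Qed.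

Definition preim_subcomplex : subcomplex A :=
  Subcomplex preim_simplexW preim_simplex_face.

Lemma preim_vertex (v : preim_subcomplex) : sub_simplex L [fset f (val v)].
Proof.
have /= := valP v; rewrite inE => -[_]; congr sub_simplex.
apply/fsetP => y; rewrite inE; apply/imfsetP/eqP => /= [[z]|->].
  by rewrite inE => /eqP -> ->.
by exists (val v); rewrite ?inE.
Qed.

(** The corestriction of [f]: categoricity of [L] is tested on maps into [L] itself, not into
    [B]. *)
Definition preim_fun (v : preim_subcomplex) : L :=
  exist _ (f (val v)) (mem_set (preim_vertex v)).

Lemma preim_fun_simplex (s : {fset preim_subcomplex}) :
  simplex s -> simplex [fset preim_fun x | x in s].
Proof. by case=> _; rewrite /= /sub_scomplex_simplex -!imfset_comp. Qed.

Definition preim_smap : smap preim_subcomplex L := SMap preim_fun_simplex.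

End Preimage.

Lemma m_categorical_preim (m : nat) (A B : scomplex) (f : smap A B)
    (g : smap B A) (a0 : A) (b0 : B) (L : subcomplex B) :
  edge_path_connected A -> contiguity_class (comp_smap g f) (id_smap A) ->
  m_categorical m b0 L -> m_categorical m a0 (preim_subcomplex f L).
Proof.
move=> conA gf catL P eta dimP.
(* [eta'] is [eta] seen in [A], [theta] its image in [L]; [f \o eta'] and [theta] followed by the
   inclusion of [L] agree pointwise. *)
pose eta' := comp_smap (incl_smap (preim_subcomplex f L)) eta.
pose theta := comp_smap (preim_smap f L) eta.
apply: (@rt_trans _ _ _ (comp_smap (comp_smap g f) eta')).
  apply: (contiguity_class_comp (h := id_smap A) (e := eta') _ _
    (contiguity_class_sym gf)) => //.
apply: (@rt_trans _ _ _ (cst_smap P (g b0))).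
  (* [theta] has the same source [P] as [eta], so [dimP] still applies; composing with [g] turns the
     constant [b0] into [g b0]. *)
  apply: (contiguity_class_comp (h := g) (e := id_smap P) _ _
    (catL P theta dimP)) => //.
apply: rt_trans (contiguity_class_cst P (g b0) a0 conA) _.
exact: contiguity_class_eqfun.
Qed.

Lemma m_categorical_cover_dominated (m : nat) (A B : scomplex) (f : smap A B)
    (g : smap B A) (a0 : A) (b0 : B) (k : nat) :
  edge_path_connected A -> contiguity_class (comp_smap g f) (id_smap A) ->
  m_categorical_cover m b0 k -> m_categorical_cover m a0 k.
Proof.
move=> conA gf [L [coverL catL]].
exists (fun j => preim_subcomplex f (L j)); split=> [s As|j].
  by have [j Ls] := coverL _ (smap_simplex f As); exists j.
exact: m_categorical_preim conA gf (catL j).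
Qed.

Theorem corollary6p1 (m : nat) (hm : 1 <= m) (K K' : scomplex)
    (hK : edge_path_connected K) (hK' : edge_path_connected K')
    (a0 : K) (a0' : K') :
  same_strong_homotopy_type K K' -> scat m K a0 = scat m K' a0'.
Proof.
move=> [f [g [fg gf]]].
(* Equality of the cover predicates settles the finite and infinite values together. Covers of [K]
   pull back along [g], those of [K'] along [f]. *)
have coverE : m_categorical_cover m a0 = m_categorical_cover m a0'.
  apply/funext => k; apply/propext; split.
    exact: m_categorical_cover_dominated hK' fg.
  exact: m_categorical_cover_dominated hK gf.
by rewrite /scat coverE.
Qed.
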